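(* Let $r_1,\dots,r_4\in\mathbb{C}$ and $s_1,\dots,s_6\in\mathbb{C}\setminus\{0\}$. Let $\mathbb{B}=\mathbb{B}(r_1,\dots,r_4;s_1,\dots,s_6)$, acting as a bounded linear operator on $c_0$. Then $$\sigma(\mathbb{B},c_0)=\left\{\lambda\in\mathbb{C}: (|\lambda-r_1||\lambda-r_2||\lambda-r_3||\lambda-r_4|)^{1/4}\le (|s_1||s_2||s_3||s_4||s_5||s_6|)^{1/6}\right\}.$$
   Context: $c_0$ is the Banach space of complex sequences $x=(x_k)_{k\ge 0}$ converging to $0$, with the supremum norm. For an integer $a$ and $n\in\mathbb{N}$, $a\,(\mathrm{mod}\ n)$ denotes the remainder in $\{0,\dots,n-1\}$ of $a$ modulo $n$. The matrix $\mathbb{B}(r_1,\dots,r_4;s_1,\dots,s_6)=(b_{ij})_{i,j\ge 0}$ is the infinite lower triangular matrix with $b_{ij}=r_{j(\mathrm{mod}\ 4)+1}$ if $i=j$, $b_{ij}=s_{j(\mathrm{mod}\ 6)+1}$ if $i=j+1$, and $b_{ij}=0$ otherwise; it acts on sequences by $(\mathbb{B}x)_k=\sum_{j}b_{kj}x_j$. $\sigma(T,X)$ is the spectrum of the operator $T$ on $X$: the set of $\lambda\in\mathbb{C}$ for which it is not the case that $T-\lambda I$ is injective with inverse (defined on its range) bounded and with dense range. *)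

(* Defs.v *)
From Stdlib Require Import Reals Lra Lia List Arith.
From Stdlib Require Import FunctionalExtensionality ProofIrrelevance.
From Coquelicot Require Import Coquelicot.

Open Scope R_scope.

(** * Operators on normed modules and their spectrum *)

(** [is_linear] of Coquelicot includes boundedness: it asks for [M] with
    [norm (T x) <= M * norm x] for all [x]. *)
Record BoundedOperator {K : AbsRing} (X : NormedModule K) := mkBoundedOperator {
  op_fun :> X -> X;
  op_is_linear : is_linear op_fun
}.
Arguments mkBoundedOperator {K X} _ _.
Arguments op_fun {K X} _ _.
Arguments op_is_linear {K X} _.

Definition shifted {K : AbsRing} {X : NormedModule K}
    (T : BoundedOperator X) (l : K) (x : X) : X := minus (T x) (scal l x).

Definition in_range {X Y : Type} (f : X -> Y) (y : Y) : Prop := exists x, y = f x.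

Definition injective {X Y : Type} (f : X -> Y) : Prop :=
  forall x1 x2, f x1 = f x2 -> x1 = x2.

(** The inverse lives on the range of [f] only: the values of [g] outside the
    range are irrelevant. *)
Definition has_bounded_inverse_on_range {K : AbsRing} {X : NormedModule K}
    (f : X -> X) : Prop :=
  exists g : X -> X,
    (forall x, g (f x) = x) /\
    exists M : R, forall y, in_range f y -> norm (g y) <= M * norm y.

Definition dense {X : UniformSpace} (A : X -> Prop) : Prop :=
  forall (y : X) (eps : posreal), exists z, A z /\ ball y eps z.

Definition resolvent_set {K : AbsRing} {X : NormedModule K}
    (T : BoundedOperator X) (l : K) : Prop :=
  injective (shifted T l) /\
  has_bounded_inverse_on_range (shifted T l) /\
  dense (in_range (shifted T l)).

Definition spectrum {K : AbsRing} {X : NormedModule K}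
    (T : BoundedOperator X) (l : K) : Prop := ~ resolvent_set T l.

(** * The space c0 of complex null sequences with the supremum norm *)

Definition null_seq (x : nat -> C) : Prop :=
  filterlim x eventually (locally (T := C_UniformSpace) (RtoC 0)).

Lemma null_seq_Cmod (x : nat -> C) :
  null_seq x <-> is_lim_seq (fun k => Cmod (x k)) 0.
Proof.
  unfold null_seq; split; intros H.
  - unfold is_lim_seq; simpl; rewrite <- Cmod_0.
    exact (filterlim_comp _ _ _ x _ _ _ _ H
      (filterlim_norm (V := C_NormedModule) (RtoC 0))).
  - exact (filterlim_norm_zero (V := C_NormedModule) x H).
Qed.

Record c0 := mk_c0 { c0_val :> nat -> C; c0_null : null_seq c0_val }.

Lemma c0_ext (x y : c0) : (forall k, x k = y k) -> x = y.
Proof.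
  destruct x as [x hx], y as [y hy]; simpl; intros H.
  assert (E : x = y) by (apply functional_extensionality; exact H).
  subst y; f_equal; apply proof_irrelevance.
Qed.

Lemma null_seq_le (x : nat -> C) (u : nat -> R) :
  (forall k, Cmod (x k) <= u k) -> is_lim_seq u 0 -> null_seq x.
Proof.
  intros H Hu; apply null_seq_Cmod.
  apply is_lim_seq_le_le with (fun _ => 0) u; auto.
  - intros k; split; [apply Cmod_ge_0 | apply H].
  - apply is_lim_seq_const.
Qed.

Lemma null_seq_zero : null_seq (fun _ => RtoC 0).
Proof.
  apply null_seq_le with (fun _ => 0).
  - intros _; rewrite Cmod_0; lra.
  - apply is_lim_seq_const.
Qed.

Lemma null_seq_plus (x y : nat -> C) :
  null_seq x -> null_seq y -> null_seq (fun k => Cplus (x k) (y k)).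
Proof.
  intros Hx Hy; apply null_seq_le with (fun k => Cmod (x k) + Cmod (y k)).
  - intros k; apply Cmod_triangle.
  - replace (Finite 0) with (Finite (0 + 0)) by (f_equal; ring).
    apply is_lim_seq_plus'; now apply null_seq_Cmod.
Qed.

Lemma null_seq_scal (a : C) (x : nat -> C) :
  null_seq x -> null_seq (fun k => Cmult a (x k)).
Proof.
  intros Hx; apply null_seq_le with (fun k => Cmod a * Cmod (x k)).
  - intros k; rewrite Cmod_mult; lra.
  - replace (Finite 0) with (Rbar_mult (Cmod a) 0)
      by (simpl; f_equal; ring).
    apply is_lim_seq_scal_l; now apply null_seq_Cmod.
Qed.

Lemma null_seq_opp (x : nat -> C) : null_seq x -> null_seq (fun k => Copp (x k)).
Proof.
  intros Hx; apply null_seq_le with (fun k => Cmod (x k)).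
  - intros k; rewrite Cmod_opp; lra.
  - now apply null_seq_Cmod.
Qed.

Definition c0_zero : c0 := mk_c0 _ null_seq_zero.
Definition c0_plus (x y : c0) : c0 :=
  mk_c0 _ (null_seq_plus x y (c0_null x) (c0_null y)).
Definition c0_opp (x : c0) : c0 := mk_c0 _ (null_seq_opp x (c0_null x)).
Definition c0_scal (a : C) (x : c0) : c0 := mk_c0 _ (null_seq_scal a x (c0_null x)).

Definition c0_norm (x : c0) : R := real (Sup_seq (fun k => Finite (Cmod (x k)))).

Lemma c0_bounded (x : c0) : exists M : R, forall k, Cmod (x k) <= M.
Proof.
  assert (H : ex_finite_lim_seq (fun k => Cmod (x k)))
    by (exists 0; apply null_seq_Cmod, c0_null).
  destruct H as [l Hl]; apply is_lim_seq_Reals in Hl.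
  destruct (maj_by_pos (fun k => Cmod (x k)) (exist _ l Hl)) as [M [_ HM]].
  exists M; intros k; specialize (HM k).
  rewrite Rabs_pos_eq in HM; [exact HM | apply Cmod_ge_0].
Qed.

Lemma c0_norm_is_sup (x : c0) :
  is_sup_seq (fun k => Finite (Cmod (x k))) (Finite (c0_norm x)).
Proof.
  unfold c0_norm; set (u := fun k => Finite (Cmod (x k))).
  pose proof (Sup_seq_correct u) as H.
  destruct (c0_bounded x) as [M HM].
  destruct (Sup_seq u) as [s| |] eqn:E; simpl in *; auto; exfalso.
  - destruct (H M) as [n Hn]; unfold u in Hn; simpl in Hn; specialize (HM n); lra.
  - specialize (H (-1) O); unfold u in H; simpl in H.
    pose proof (Cmod_ge_0 (x O)); lra.
Qed.

Lemma Cmod_le_c0_norm (x : c0) (k : nat) : Cmod (x k) <= c0_norm x.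
Proof.
  apply Rnot_lt_le; intros H.
  assert (He : 0 < Cmod (x k) - c0_norm x) by lra.
  destruct (c0_norm_is_sup x (mkposreal _ He)) as [H1 _].
  specialize (H1 k); simpl in H1; lra.
Qed.

Lemma c0_norm_le (x : c0) (M : R) : (forall k, Cmod (x k) <= M) -> c0_norm x <= M.
Proof.
  intros HM; apply Rnot_lt_le; intros H.
  assert (He : 0 < c0_norm x - M) by lra.
  destruct (c0_norm_is_sup x (mkposreal _ He)) as [_ [n Hn]].
  specialize (HM n); simpl in Hn; lra.
Qed.

Definition c0_AbelianMonoid_mixin : AbelianMonoid.mixin_of c0.
Proof.
  apply (AbelianMonoid.Mixin c0 c0_plus c0_zero);
    intros; apply c0_ext; intros k; simpl; ring.
Defined.
Canonical c0_AbelianMonoid := AbelianMonoid.Pack c0 c0_AbelianMonoid_mixin c0.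

Definition c0_AbelianGroup_mixin : AbelianGroup.mixin_of c0_AbelianMonoid.
Proof.
  apply (AbelianGroup.Mixin c0_AbelianMonoid c0_opp).
  intros; apply c0_ext; intros k; simpl; ring.
Defined.
Canonical c0_AbelianGroup :=
  AbelianGroup.Pack c0
    (AbelianGroup.Class c0 c0_AbelianMonoid_mixin c0_AbelianGroup_mixin) c0.

Definition c0_ModuleSpace_mixin : ModuleSpace.mixin_of C_AbsRing c0_AbelianGroup.
Proof.
  apply (ModuleSpace.Mixin C_AbsRing c0_AbelianGroup c0_scal);
    intros; apply c0_ext; intros k; simpl;
    unfold mult, one, plus; simpl; ring.
Defined.
Canonical c0_ModuleSpace :=
  ModuleSpace.Pack C_AbsRing c0
    (ModuleSpace.Class C_AbsRing c0
      (AbelianGroup.class c0_AbelianGroup) c0_ModuleSpace_mixin) c0.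

Definition c0_ball (x : c0) (eps : R) (y : c0) : Prop :=
  c0_norm (c0_plus y (c0_opp x)) < eps.

Definition c0_UniformSpace_mixin : UniformSpace.mixin_of c0.
Proof.
  apply (UniformSpace.Mixin c0 c0_zero c0_ball); unfold c0_ball.
  - intros x [e he]; simpl; apply Rle_lt_trans with (2 := he).
    apply c0_norm_le; intros k; simpl.
    rewrite Cplus_opp_r, Cmod_0; lra.
  - intros x y e H; apply Rle_lt_trans with (2 := H).
    apply c0_norm_le; intros k.
    apply Rle_trans with (2 := Cmod_le_c0_norm _ k); simpl.
    rewrite <- Cmod_opp; right; f_equal; ring.
  - intros x y z e1 e2 H1 H2.
    apply Rle_lt_trans with (2 := Rplus_lt_compat _ _ _ _ H1 H2).
    apply c0_norm_le; intros k.
    eapply Rle_trans; [|apply Rplus_le_compat;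
      [apply (Cmod_le_c0_norm _ k) | apply (Cmod_le_c0_norm _ k)]]; simpl.
    eapply Rle_trans; [|apply Cmod_triangle]; right; f_equal; ring.
Defined.
Canonical c0_UniformSpace := UniformSpace.Pack c0 c0_UniformSpace_mixin c0.

Canonical c0_NormedModuleAux :=
  NormedModuleAux.Pack C_AbsRing c0
    (NormedModuleAux.Class C_AbsRing c0
      (ModuleSpace.class _ c0_ModuleSpace) c0_UniformSpace_mixin) c0.

Definition c0_NormedModule_mixin : NormedModule.mixin_of C_AbsRing c0_NormedModuleAux.
Proof.
  apply (NormedModule.Mixin C_AbsRing c0_NormedModuleAux c0_norm 1).
  - intros x y; apply c0_norm_le; intros k; simpl.
    eapply Rle_trans; [apply Cmod_triangle|].
    apply Rplus_le_compat; apply Cmod_le_c0_norm.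
  - intros l x; apply c0_norm_le; intros k; simpl; rewrite Cmod_mult.
    apply Rmult_le_compat_l; [apply Cmod_ge_0 | apply Cmod_le_c0_norm].
  - intros x y eps H; exact H.
  - intros x y eps H; rewrite Rmult_1_l; exact H.
  - intros x H; apply c0_ext; intros k; simpl.
    apply Cmod_eq_0, Rle_antisym; [rewrite <- H; apply Cmod_le_c0_norm | apply Cmod_ge_0].
Defined.
Canonical c0_NormedModule :=
  NormedModule.Pack C_AbsRing c0
    (NormedModule.Class C_AbsRing c0
      (NormedModuleAux.class _ c0_NormedModuleAux) c0_NormedModule_mixin) c0.

(** * The doubly periodic lower bidiagonal matrix *)

(** [nth] is 0-based, so the paper's [r_(j mod m + 1)] is the entry of index
    [j mod m] of the list [r_1, ..., r_m]. *)
Definition periodic (l : list C) (j : nat) : C := nth (j mod length l) l (RtoC 0).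

Definition matB (r s : list C) (i j : nat) : C :=
  if Nat.eqb i j then periodic r j
  else if Nat.eqb i (S j) then periodic s j
  else RtoC 0.

(** Row [k] of a lower triangular matrix vanishes beyond column [k], so that the
    series [sum_j a_kj x_j] is this finite sum; see [lower_act_is_series]. *)
Definition lower_act (a : nat -> nat -> C) (x : nat -> C) (k : nat) : C :=
  sum_n (fun j => Cmult (a k j) (x j)) k.

Lemma lower_act_is_series (a : nat -> nat -> C) (x : nat -> C) (k : nat) :
  (forall i j, (i < j)%nat -> a i j = RtoC 0) ->
  is_series (V := C_NormedModule) (fun j => Cmult (a k j) (x j)) (lower_act a x k).
Proof.
  intros Ha.
  assert (E : forall n, (k <= n)%nat ->
    sum_n (fun j => Cmult (a k j) (x j)) n = lower_act a x k).
  { intros n Hn; induction Hn as [|n Hn IH]; [reflexivity|].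
    rewrite sum_Sn, IH, Ha by lia.
    unfold plus; simpl; ring. }
  unfold is_series.
  apply filterlim_ext_loc with (fun _ => lower_act a x k).
  - exists k; intros n Hn; symmetry; apply E, Hn.
  - apply filterlim_const.
Qed.

Lemma matB_lower (r s : list C) (i j : nat) : (i < j)%nat -> matB r s i j = RtoC 0.
Proof.
  intros H; unfold matB.
  destruct (Nat.eqb_spec i j); [lia|].
  destruct (Nat.eqb_spec i (S j)); [lia|reflexivity].
Qed.

Lemma lower_act_matB_0 (r s : list C) (x : nat -> C) :
  lower_act (matB r s) x 0 = Cmult (periodic r 0) (x O).
Proof. unfold lower_act; rewrite sum_O; reflexivity. Qed.

Lemma lower_act_matB_S (r s : list C) (x : nat -> C) (k : nat) :
  lower_act (matB r s) x (S k) =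
  Cplus (Cmult (periodic s k) (x k)) (Cmult (periodic r (S k)) (x (S k))).
Proof.
  assert (H0 : forall n, (n < k)%nat ->
    sum_n (fun j => Cmult (matB r s (S k) j) (x j)) n = RtoC 0).
  { intros n; induction n as [|n IH]; intros Hn.
    - rewrite sum_O; unfold matB; simpl.
      destruct (Nat.eqb_spec k 0); [lia|]; ring.
    - rewrite sum_Sn, IH by lia; unfold matB.
      destruct (Nat.eqb_spec (S k) (S n)); [lia|].
      destruct (Nat.eqb_spec (S k) (S (S n))); [lia|].
      unfold plus; simpl; ring. }
  assert (H1 : sum_n (fun j => Cmult (matB r s (S k) j) (x j)) k =
               Cmult (periodic s k) (x k)).
  { assert (Em : matB r s (S k) k = periodic s k).
    { unfold matB; destruct (Nat.eqb_spec (S k) k); [lia|].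
      now rewrite Nat.eqb_refl. }
    destruct k as [|k].
    - rewrite sum_O, Em; reflexivity.
    - rewrite sum_Sn, H0, Em by lia; unfold plus; simpl; ring. }
  unfold lower_act; rewrite sum_Sn, H1; unfold matB at 1; rewrite Nat.eqb_refl.
  reflexivity.
Qed.

Lemma periodic_bounded (l : list C) : exists M, 0 <= M /\ forall j, Cmod (periodic l j) <= M.
Proof.
  assert (H : exists M, 0 <= M /\ forall i, Cmod (nth i l (RtoC 0)) <= M).
  { induction l as [|a l [M [HM IH]]].
    - exists 0; split; [lra|]; intros [|i]; simpl; rewrite Cmod_0; lra.
    - exists (Rmax (Cmod a) M); split.
      + apply Rle_trans with (1 := HM), Rmax_r.
      + intros [|i]; simpl; [apply Rmax_l | apply Rle_trans with (1 := IH i), Rmax_r]. }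
  destruct H as [M [HM H]]; exists M; split; auto; intros j; apply H.
Qed.

Lemma opB_null (r s : list C) (x : c0) : null_seq (lower_act (matB r s) x).
Proof.
  destruct (periodic_bounded r) as [A [HA Hr]], (periodic_bounded s) as [D [HD Hs]].
  pose proof (proj1 (null_seq_Cmod x) (c0_null x)) as Hx.
  apply null_seq_Cmod, is_lim_seq_incr_1, null_seq_Cmod.
  apply null_seq_le with (fun k => D * Cmod (x k) + A * Cmod (x (S k))).
  - intros k; rewrite lower_act_matB_S.
    eapply Rle_trans; [apply Cmod_triangle|]; rewrite !Cmod_mult.
    apply Rplus_le_compat; apply Rmult_le_compat_r; auto using Cmod_ge_0.
  - replace (Finite 0) with (Finite (D * 0 + A * 0)) by (f_equal; ring).
    apply is_lim_seq_plus'.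
    + apply (is_lim_seq_scal_l _ D (Finite 0)), Hx.
    + apply (is_lim_seq_scal_l _ A (Finite 0)).
      apply (is_lim_seq_incr_1 (fun k => Cmod (x k))), Hx.
Qed.

Definition opB_fun (r s : list C) (x : c0) : c0 := mk_c0 _ (opB_null r s x).

Lemma opB_is_linear (r s : list C) :
  is_linear (U := c0_NormedModule) (V := c0_NormedModule) (opB_fun r s).
Proof.
  split.
  - intros x y; apply c0_ext; intros [|k]; simpl;
      rewrite ?lower_act_matB_0, ?lower_act_matB_S; simpl; ring.
  - intros a x; apply c0_ext; intros [|k]; simpl;
      rewrite ?lower_act_matB_0, ?lower_act_matB_S; simpl; ring.
  - destruct (periodic_bounded r) as [A [HA Hr]], (periodic_bounded s) as [D [HD Hs]].
    exists (D + A + 1); split; [lra|]; intros x.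
    change (c0_norm (opB_fun r s x) <= (D + A + 1) * c0_norm x).
    assert (HN : 0 <= c0_norm x)
      by (apply Rle_trans with (1 := Cmod_ge_0 (x O)), Cmod_le_c0_norm).
    assert (Bd : forall c M k, 0 <= M -> Cmod c <= M ->
              Cmod (Cmult c (x k)) <= M * c0_norm x).
    { intros c M k HM Hc; rewrite Cmod_mult.
      apply Rmult_le_compat; auto using Cmod_ge_0, Cmod_le_c0_norm. }
    apply c0_norm_le; intros [|k]; simpl.
    + rewrite lower_act_matB_0.
      pose proof (Bd _ _ O HA (Hr O)); nra.
    + rewrite lower_act_matB_S.
      pose proof (Bd _ _ (S k) HA (Hr (S k))); pose proof (Bd _ _ k HD (Hs k)).
      eapply Rle_trans; [apply Cmod_triangle|]; nra.
Qed.

Definition opB (r s : list C) : BoundedOperator c0_NormedModule :=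
  mkBoundedOperator (opB_fun r s) (opB_is_linear r s).

(** * Roots of nonnegative reals *)

(** [Rpower 0 y] is [1] in Stdlib (because [ln 0 = 0]), hence the case split. *)
Definition nroot (n : nat) (x : R) : R :=
  if Rle_dec x 0 then 0 else Rpower x (/ INR n).

Lemma nroot_ge_0 (n : nat) (x : R) : 0 <= nroot n x.
Proof.
  unfold nroot; destruct (Rle_dec x 0); [lra|].
  left; apply exp_pos.
Qed.

Lemma nroot_pow (n : nat) (x : R) : (0 < n)%nat -> 0 <= x -> nroot n x ^ n = x.
Proof.
  intros Hn Hx; unfold nroot; destruct (Rle_dec x 0) as [H|H].
  - rewrite pow_i by exact Hn; lra.
  - rewrite <- Rpower_pow by apply exp_pos.
    rewrite Rpower_mult, Rinv_l, Rpower_1; auto; try lra.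
    apply not_0_INR; lia.
Qed.

(* Main.v *)
(** Put [d_k = r_k - l] and let [phi] be the sequence with [phi_0 = 1] and
    [phi_(k+1) s_k + phi_k d_k = 0], which formally annihilates the range of
    [B - l]. If [y = (B - l) x], the sum telescopes to
    [phi_0 y_0 + ... + phi_n y_n = phi_n d_n x_n]. After a period of 12 the
    modulus of [phi] is multiplied by [rho^12], where [rho] is the quotient of the
    two roots in the theorem. If [rho > 1], solving the identity for [x_n] gives a
    bounded two-sided inverse, because [phi_n] grows like [rho^n]. If [rho <= 1],
    then [phi] is bounded. A bounded inverse would bound the partial sums
    uniformly on the dense range, which forces [phi] to be summable; but then
    the sums, which tend to [0] on the range, tend to [0] for [y = e_0] as well,
    where they equal [1]. *)

Require Import Defs.
From Stdlib Require Import Reals List.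
From Stdlib Require Import Lra Lia Arith.
From Coquelicot Require Import Coquelicot.
Import ListNotations.

Open Scope R_scope.

(** * Real sequences: bounds from one period, and perturbed contractions *)

(** Steps of [n] lead any index back to one of the first [n], whose values have a maximum. Only an
    inequality is assumed, because for growth factors below 1 the modulus of [phi] decreases from
    one period to the next. *)
Lemma periodic_le_bounded (f : nat -> R) (n : nat) :
  (0 < n)%nat -> (forall k, f (k + n)%nat <= f k) ->
  exists M, 0 < M /\ forall k, f k <= M.
Proof.
  intros Hn Hf.
  assert (H : forall p, exists M, 0 < M /\ forall k, (k < p)%nat -> f k <= M).
  { induction p as [|p [M [HM IH]]].
    - exists 1; split; [lra | intros; lia].
    - exists (Rmax M (f p)); split.
      + apply Rlt_le_trans with (1 := HM), Rmax_l.
      + intros k Hk; destruct (Nat.eq_dec k p) as [->|]; [apply Rmax_r|].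
        apply Rle_trans with M; [apply IH; lia | apply Rmax_l]. }
  destruct (H n) as [M [HM Hs]]; exists M; split; [exact HM|].
  intros k; induction k as [k IH] using (well_founded_induction lt_wf).
  destruct (lt_dec k n) as [Hk|Hk]; [auto|].
  replace k with (k - n + n)%nat by lia.
  apply Rle_trans with (1 := Hf _), IH; lia.
Qed.

(** The lower bound comes from an upper bound on the reciprocals. *)
Lemma periodic_pos_bounds (f : nat -> R) (n : nat) :
  (0 < n)%nat -> (forall k, f (k + n)%nat = f k) -> (forall k, 0 < f k) ->
  exists m M, 0 < m /\ 0 < M /\ forall k, m <= f k <= M.
Proof.
  intros Hn Hf Hpos.
  destruct (periodic_le_bounded f n) as [M [HM H]]; auto.
  { intros k; rewrite Hf; lra. }
  destruct (periodic_le_bounded (fun k => / f k) n) as [N [HN H']]; auto.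
  { intros k; rewrite Hf; lra. }
  exists (/ N), M; repeat split; auto using Rinv_0_lt_compat.
  rewrite <- (Rinv_inv (f k)); apply Rinv_le_contravar; auto.
  apply Rinv_0_lt_compat, Hpos.
Qed.

(** [c / (1 - q)] is the fixed point of [t -> q * t + c], which is increasing. *)
Lemma contraction_bounded (u : nat -> R) (q c : R) :
  0 <= q < 1 -> u O <= c / (1 - q) -> (forall k, u (S k) <= q * u k + c) ->
  forall k, u k <= c / (1 - q).
Proof.
  intros Hq H0 H; induction k as [|k IH]; [exact H0|].
  apply Rle_trans with (1 := H k).
  replace (c / (1 - q)) with (q * (c / (1 - q)) + c) by (field; lra).
  apply Rplus_le_compat_r, Rmult_le_compat_l; tauto.
Qed.

Lemma contraction_null (u c : nat -> R) (q : R) :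
  0 <= q < 1 -> (forall k, 0 <= u k) -> is_lim_seq c 0 ->
  (forall k, u (S k) <= q * u k + c k) -> is_lim_seq u 0.
Proof.
  intros Hq Hu Hc H; apply is_lim_seq_spec; intros [e He]; simpl.
  (* A perturbation below this threshold has its fixed point at [e / 2]; what remains of the start
     value [u N] decays geometrically and takes the other half of [e]. *)
  assert (He' : 0 < e / 2 * (1 - q)) by (apply Rmult_lt_0_compat; lra).
  apply is_lim_seq_spec in Hc; destruct (Hc (mkposreal _ He')) as [N HN]; simpl in HN.
  assert (B : forall k, u (N + k)%nat <= q ^ k * u N + e / 2).
  { induction k as [|k IH].
    - rewrite Nat.add_0_r; simpl; lra.
    - rewrite Nat.add_succ_r; apply Rle_trans with (1 := H _).
      specialize (HN (N + k)%nat ltac:(lia)).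
      rewrite Rminus_0_r in HN; apply Rabs_def2 in HN.
      simpl; nra. }
  assert (G : is_lim_seq (fun k => q ^ k * u N) 0).
  { replace (Finite 0) with (Rbar_mult 0 (u N)) by (simpl; f_equal; ring).
    apply is_lim_seq_scal_r, is_lim_seq_geom; rewrite Rabs_pos_eq; lra. }
  apply is_lim_seq_spec in G.
  destruct (G (mkposreal (e / 2) ltac:(lra))) as [K HK]; simpl in HK.
  exists (N + K)%nat; intros k Hk.
  specialize (HK (k - N)%nat ltac:(lia)); specialize (B (k - N)%nat).
  replace (N + (k - N))%nat with k in B by lia.
  rewrite Rminus_0_r in *; apply Rabs_def2 in HK.
  rewrite Rabs_pos_eq by apply Hu; lra.
Qed.

(** * Finitely supported sequences, partial pairings, and the sequence [phi] *)

Lemma null_seq_finite_support (x : nat -> C) (n : nat) :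
  (forall k, (n < k)%nat -> x k = RtoC 0) -> null_seq x.
Proof.
  intros H; unfold null_seq.
  apply filterlim_ext_loc with (2 := null_seq_zero).
  exists (S n); intros k Hk; symmetry; apply H; lia.
Qed.

Lemma c0_norm_ge_0 (x : c0) : 0 <= c0_norm x.
Proof. apply Rle_trans with (1 := Cmod_ge_0 (x O)), Cmod_le_c0_norm. Qed.

Lemma periodic_add (l : list C) (n k : nat) :
  Nat.divide (length l) n -> periodic l (k + n) = periodic l k.
Proof.
  intros [q ->]; unfold periodic.
  (* For the empty list, divisibility by 0 forces the shift to be 0. *)
  destruct l as [|a l]; [now destruct q; rewrite ?Nat.mul_0_r, ?Nat.add_0_r|].
  now rewrite Nat.Div0.mod_add.
Qed.

Definition pairing (phi y : nat -> C) (n : nat) : C :=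
  sum_n (fun k => Cmult (phi k) (y k)) n.

Lemma pairing_0 (phi y : nat -> C) : pairing phi y 0 = Cmult (phi O) (y O).
Proof. unfold pairing; now rewrite sum_O. Qed.

Lemma pairing_S (phi y : nat -> C) (n : nat) :
  pairing phi y (S n) = Cplus (pairing phi y n) (Cmult (phi (S n)) (y (S n))).
Proof. unfold pairing; now rewrite sum_Sn. Qed.

(** Hoelder's inequality between the l1 and supremum norms, on partial sums. *)
Lemma pairing_minus_le (phi y z : nat -> C) (e : R) (n : nat) :
  (forall k, Cmod (y k - z k) <= e) ->
  Cmod (pairing phi y n - pairing phi z n) <= sum_n (fun k => Cmod (phi k)) n * e.
Proof.
  intros H.
  assert (T : forall k, Cmod (phi k * y k - phi k * z k) <= Cmod (phi k) * e).
  { intros k; replace (phi k * y k - phi k * z k)%C with (phi k * (y k - z k))%C by ring.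
    rewrite Cmod_mult; apply Rmult_le_compat_l; auto using Cmod_ge_0. }
  induction n as [|n IH].
  - rewrite !pairing_0, sum_O; apply T.
  - rewrite !pairing_S, sum_Sn.
    replace (pairing phi y n + phi (S n) * y (S n) -
             (pairing phi z n + phi (S n) * z (S n)))%C
      with ((pairing phi y n - pairing phi z n) +
            (phi (S n) * y (S n) - phi (S n) * z (S n)))%C by ring.
    apply Rle_trans with (1 := Cmod_triangle _ _).
    unfold plus; simpl; rewrite Rmult_plus_distr_r.
    apply Rplus_le_compat; auto.
Qed.

Definition diag (r : list C) (l : C) (k : nat) : C := Cminus (periodic r k) l.

(** In closed form, the product of [- d_j / s_j] over [j < k]. *)
Fixpoint annihilator (r s : list C) (l : C) (k : nat) : C :=
  match k with
  | O => RtoC 1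
  | S k => Copp (Cmult (annihilator r s l k) (Cdiv (diag r l k) (periodic s k)))
  end.

Lemma shifted_0 (r s : list C) (l : C) (x : c0) :
  c0_val (shifted (opB r s) l x) O = Cmult (diag r l 0) (x O).
Proof. unfold diag; simpl; rewrite lower_act_matB_0; ring. Qed.

Lemma shifted_S (r s : list C) (l : C) (x : c0) (k : nat) :
  c0_val (shifted (opB r s) l x) (S k) =
  Cplus (Cmult (periodic s k) (x k)) (Cmult (diag r l (S k)) (x (S k))).
Proof. unfold diag; simpl; rewrite lower_act_matB_S; ring. Qed.

Lemma diag_bounded (r : list C) (l : C) :
  exists D, 0 <= D /\ forall k, Cmod (diag r l k) <= D.
Proof.
  destruct (periodic_bounded r) as [A [HA H]].
  exists (A + Cmod l); split; [pose proof (Cmod_ge_0 l); lra|].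
  intros k; unfold diag, Cminus; apply Rle_trans with (1 := Cmod_triangle _ _).
  rewrite Cmod_opp; apply Rplus_le_compat_r, H.
Qed.

(** * Spectrum and resolvent set in terms of the growth of [phi] *)

Section Annihilator.

Variables (r s : list C) (l : C).
Hypothesis s_neq_0 : forall k, periodic s k <> RtoC 0.

Let phi := annihilator r s l.
Let d := diag r l.

(** In each new summand, [phi (S n) * s_n * x n] cancels the previous total [phi n * d n * x n]. *)
Lemma pairing_shifted (x : c0) (n : nat) :
  pairing phi (c0_val (shifted (opB r s) l x)) n = Cmult (phi n) (Cmult (d n) (x n)).
Proof.
  induction n as [|n IH].
  - rewrite pairing_0, shifted_0; reflexivity.
  - rewrite pairing_S, IH, shifted_S; unfold phi, d; simpl.
    field; apply s_neq_0.
Qed.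

Lemma annihilator_bounded_spectrum (M : R) :
  (forall k, Cmod (phi k) <= M) -> spectrum (opB r s) l.
Proof.
  intros HM [_ [[g [Hg [K HK]]] Hdense]].
  destruct (diag_bounded r l) as [D [HD Hd]].
  assert (HM0 : 0 <= M) by (apply Rle_trans with (2 := HM O), Cmod_ge_0).
  (* A common bound for all partial pairings, as functionals on the range; the absolute value covers
     a possibly negative [K]. *)
  pose (B := M * D * Rabs K).
  assert (HB : 0 <= B)
    by (unfold B; apply Rmult_le_pos; [apply Rmult_le_pos; auto | apply Rabs_pos]).
  assert (Hphid : forall n, Cmod (phi n * d n) <= M * D).
  { intros n; rewrite Cmod_mult; apply Rmult_le_compat; auto using Cmod_ge_0. }
  assert (HS : forall (x : c0) n,
    Cmod (pairing phi (c0_val (shifted (opB r s) l x)) n) <= M * D * Cmod (x n)).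
  { intros x n; rewrite pairing_shifted, Cmult_assoc, Cmod_mult.
    apply Rmult_le_compat_r; auto using Cmod_ge_0. }
  assert (Hx : forall (x : c0) n,
    Cmod (pairing phi (c0_val (shifted (opB r s) l x)) n) <=
    B * c0_norm (shifted (opB r s) l x)).
  { intros x n; apply Rle_trans with (1 := HS x n).
    unfold B; rewrite (Rmult_assoc (M * D)).
    apply Rmult_le_compat_l; [now apply Rmult_le_pos|].
    apply Rle_trans with (1 := Cmod_le_c0_norm x n).
    pose proof (HK _ (ex_intro _ x eq_refl)) as H; rewrite Hg in H.
    apply Rle_trans with (1 := H), Rmult_le_compat_r; [apply c0_norm_ge_0 | apply Rle_abs]. }
  assert (Hclose : forall (y : c0) (e : R), 0 < e -> exists x : c0,
    forall k, Cmod (c0_val (shifted (opB r s) l x) k - y k) <= e).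
  { intros y e He; destruct (Hdense y (mkposreal e He)) as [z [[x ->] Hz]].
    exists x; intros k; left; apply Rle_lt_trans with (2 := Hz).
    apply (Cmod_le_c0_norm (c0_plus (shifted (opB r s) l x) (c0_opp y)) k). }
  assert (Hsum : forall n, sum_n (fun k => Cmod (phi k)) n <= 3 * B).
  { intros n.
    (* Test the pairing on the phases conjugate to those of [phi]; where
       [phi k = 0] the entry is [0 * / 0 = 0]. *)
    pose (y k := if le_dec k n then Cmult (Cconj (phi k)) (Cinv (RtoC (Cmod (phi k))))
                 else RtoC 0).
    assert (Hy : null_seq y).
    { apply null_seq_finite_support with n; intros k Hk; unfold y.
      destruct (le_dec k n); [lia | reflexivity]. }
    assert (Hphase : forall k, Cmod (y k) <= 1 /\
              ((k <= n)%nat -> (phi k * y k)%C = RtoC (Cmod (phi k)))).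
    { intros k; unfold y; destruct (le_dec k n) as [Hk|Hk];
        [|split; [rewrite Cmod_0; lra | tauto]].
      destruct (Ceq_dec (phi k) (RtoC 0)) as [E|E].
      - rewrite E, Cmod_0; replace (Cconj (RtoC 0)) with (RtoC 0)
          by (unfold Cconj, RtoC; simpl; f_equal; ring).
        rewrite !Cmult_0_l, Cmod_0; split; [lra | reflexivity].
      - pose proof (proj1 (Cmod_gt_0 _) E) as Hp.
        assert (Hp' : RtoC (Cmod (phi k)) <> RtoC 0)
          by (intros H; apply RtoC_inj in H; lra).
        split.
        + rewrite Cmod_mult, Cmod_conj, Cmod_inv, Cmod_R by exact Hp'.
          rewrite Rabs_pos_eq by lra; rewrite Rinv_r by lra; lra.
        + intros _; rewrite Cmult_assoc, <- Cmod2_conj.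
          rewrite RtoC_pow; simpl; field; exact Hp'. }
    assert (Hpair : forall j, (j <= n)%nat ->
              pairing phi y j = RtoC (sum_n (fun k => Cmod (phi k)) j)).
    { induction j as [|j IH]; intros Hj.
      - rewrite pairing_0, sum_O; now apply Hphase.
      - rewrite pairing_S, IH, sum_Sn, (proj2 (Hphase (S j))) by lia.
        unfold plus; simpl; now rewrite RtoC_plus. }
    set (A := sum_n (fun k => Cmod (phi k)) n) in *.
    (* With tolerance 1/2 the approximant [z] has norm at most 3/2 and the pairing changes by at
       most [A / 2]. Hence [A <= 3/2 * B + A / 2], which gives [A <= 3 * B]. *)
    destruct (Hclose (mk_c0 y Hy) (1 / 2) ltac:(lra)) as [x Hxy].
    change (c0_val (mk_c0 y Hy)) with y in Hxy.
    set (z := shifted (opB r s) l x) in *.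
    assert (Hz : c0_norm z <= 3 / 2).
    { apply c0_norm_le; intros k.
      replace (c0_val z k) with ((c0_val z k - y k) + y k)%C by ring.
      apply Rle_trans with (1 := Cmod_triangle _ _).
      pose proof (Hxy k) as H1; pose proof (proj1 (Hphase k)) as H2.
      lra. }
    pose proof (pairing_minus_le phi (c0_val z) y (1/2) n Hxy) as H1; fold A in H1.
    pose proof (Hx x n) as H2; fold z in H2.
    assert (H3 : A <= Cmod (pairing phi y n)).
    { rewrite Hpair by lia; rewrite Cmod_R; apply Rle_abs. }
    assert (H4 : Cmod (pairing phi y n) <=
                 Cmod (pairing phi (c0_val z) n) +
                 Cmod (pairing phi (c0_val z) n - pairing phi y n)).
    { replace (pairing phi y n) with (pairing phi (c0_val z) n +
        - (pairing phi (c0_val z) n - pairing phi y n))%C at 1 by ring.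
      apply Rle_trans with (1 := Cmod_triangle _ _); rewrite Cmod_opp; lra. }
    assert (H5 : B * c0_norm z <= B * (3 / 2)) by (apply Rmult_le_compat_l; auto).
    lra. }
  pose (e0 k := match k with O => RtoC 1 | S _ => RtoC 0 end).
  assert (He0 : null_seq e0).
  { apply null_seq_finite_support with O; intros [|k] Hk; [lia | reflexivity]. }
  assert (Hpair : forall n, pairing phi e0 n = RtoC 1).
  { induction n as [|n IH].
    - rewrite pairing_0; unfold phi; simpl; ring.
    - rewrite pairing_S, IH; simpl; ring. }
  (* Since the sums of [|phi k|] are at most [3 * B], this tolerance moves every pairing by at most
     1/2; the added 1 keeps the denominator positive when [B = 0]. *)
  assert (Hpos : 0 < / (2 * (3 * B + 1))) by (apply Rinv_0_lt_compat; lra).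
  destruct (Hclose (mk_c0 e0 He0) _ Hpos) as [x Hxe].
  change (c0_val (mk_c0 e0 He0)) with e0 in Hxe.
  (* The pairing with [e0] is constantly 1, so near [e0] it stays at least 1/2 in modulus; on the
     range it is at most [M * D * |x n|], which tends to 0. *)
  assert (Hlow : forall n, 1 / 2 <= M * D * Cmod (x n)).
  { intros n; apply Rle_trans with (2 := HS x n).
    set (z := shifted (opB r s) l x) in *.
    pose proof (pairing_minus_le phi (c0_val z) e0 _ n Hxe) as H1.
    assert (H2 : sum_n (fun k => Cmod (phi k)) n * / (2 * (3 * B + 1)) <= 1 / 2).
    { apply Rle_trans with ((3 * B + 1) * / (2 * (3 * B + 1))).
      - apply Rmult_le_compat_r; [lra|]; pose proof (Hsum n); lra.
      - right; field; lra. }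
    assert (H4 : Cmod (pairing phi e0 n) <=
                 Cmod (pairing phi (c0_val z) n) +
                 Cmod (pairing phi (c0_val z) n - pairing phi e0 n)).
    { replace (pairing phi e0 n) with (pairing phi (c0_val z) n +
        - (pairing phi (c0_val z) n - pairing phi e0 n))%C at 1 by ring.
      apply Rle_trans with (1 := Cmod_triangle _ _); rewrite Cmod_opp; lra. }
    rewrite Hpair, Cmod_1 in H4; rewrite Hpair in H1; lra. }
  assert (L : is_lim_seq (fun n => M * D * Cmod (x n)) (M * D * 0)).
  { apply (is_lim_seq_scal_l _ (M * D) (Finite 0)), null_seq_Cmod, c0_null. }
  pose proof (is_lim_seq_le _ _ _ _ Hlow (is_lim_seq_const (1 / 2)) L) as H.
  simpl in H; lra.
Qed.

Lemma annihilator_growth_resolvent (rho m M : R) :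
  1 < rho -> 0 < m ->
  (forall k, Cmod (phi k) <= M * rho ^ k) ->
  (forall k, m * rho ^ k <= Cmod (phi k * d k)) ->
  resolvent_set (opB r s) l.
Proof.
  intros Hrho Hm HM Hlow.
  assert (Hrhok : forall k, 0 < rho ^ k) by (intros k; apply pow_lt; lra).
  assert (HM0 : 0 <= M).
  { apply Rle_trans with (Cmod (phi 0)); [apply Cmod_ge_0|].
    rewrite <- (Rmult_1_r M); apply (HM O). }
  assert (Hnz : forall k, phi k <> RtoC 0 /\ d k <> RtoC 0).
  { intros k; assert (H : 0 < Cmod (phi k * d k)).
    { apply Rlt_le_trans with (2 := Hlow k), Rmult_lt_0_compat; auto. }
    apply Cmod_gt_0 in H.
    split; intros E; apply H; rewrite E; ring. }
  assert (Hq : 0 <= / rho < 1).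
  { split; [left; apply Rinv_0_lt_compat; lra|].
    rewrite <- Rinv_1; apply Rinv_lt_contravar; lra. }
  (* The candidate inverse is [pairing_shifted] solved for [x k]. Dividing the pairing by [rho ^ k]
     instead gives [u], which satisfies a perturbed contraction with factor [/ rho] and controls
     [sol] up to [/ m]. *)
  pose (sol (y : c0) k := Cdiv (pairing phi (c0_val y) k) (Cmult (phi k) (d k))).
  pose (u (y : c0) k := Cmod (pairing phi (c0_val y) k) / rho ^ k).
  assert (Hu0 : forall y k, 0 <= u y k).
  { intros y k; unfold u; apply Rdiv_le_0_compat; auto using Cmod_ge_0. }
  assert (Hu : forall y k, u y (S k) <= / rho * u y k + M * Cmod (c0_val y (S k))).
  { intros y k; unfold u; rewrite pairing_S.
    apply Rle_trans with ((Cmod (pairing phi (c0_val y) k) +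
      M * rho ^ S k * Cmod (c0_val y (S k))) / rho ^ S k).
    - apply Rmult_le_compat_r; [left; apply Rinv_0_lt_compat, Hrhok|].
      apply Rle_trans with (1 := Cmod_triangle _ _), Rplus_le_compat_l.
      rewrite Cmod_mult; apply Rmult_le_compat_r; auto using Cmod_ge_0.
    - right; simpl; field; split; [apply Rgt_not_eq, Hrhok | lra]. }
  assert (Hub : forall y k, u y k <= M * c0_norm y / (1 - / rho)).
  { intros y; assert (HN : forall k, M * Cmod (c0_val y k) <= M * c0_norm y).
    { intros k; apply Rmult_le_compat_l; auto using Cmod_le_c0_norm. }
    apply contraction_bounded; auto.
    (* Start value: [phi 0 = 1] forces [1 <= M], so [u y 0 = |y 0|] is at most [M * c0_norm y], and
       dividing by [1 - / rho <= 1] only enlarges this. *)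
    - apply Rle_trans with (M * c0_norm y).
      + unfold u; rewrite pairing_0; unfold phi; simpl.
        rewrite Cmult_1_l; unfold Rdiv; rewrite Rinv_1, Rmult_1_r.
        apply Rle_trans with (M * Cmod (c0_val y 0)); auto.
        rewrite <- (Rmult_1_l (Cmod _)) at 1; apply Rmult_le_compat_r; [apply Cmod_ge_0|].
        pose proof (HM O) as H; unfold phi in H; simpl in H; rewrite Cmod_1 in H; lra.
      + apply (proj1 (Rle_div_r _ _ (1 - / rho) ltac:(lra))).
        rewrite <- (Rmult_1_r (M * c0_norm y)) at 2; apply Rmult_le_compat_l; [|lra].
        apply Rmult_le_pos; auto using c0_norm_ge_0.
    - intros k; apply Rle_trans with (1 := Hu y k), Rplus_le_compat_l, HN. }
  assert (Hsol : forall y k, Cmod (sol y k) <= / m * u y k).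
  { intros y k; unfold sol, u.
    rewrite Cmod_div by (destruct (Hnz k); now apply Cmult_neq_0).
    replace (/ m * (Cmod (pairing phi (c0_val y) k) / rho ^ k))
      with (Cmod (pairing phi (c0_val y) k) * / (m * rho ^ k))
      by (field; split; [apply Rgt_not_eq, Hrhok | lra]).
    apply Rmult_le_compat_l; [apply Cmod_ge_0|].
    apply Rinv_le_contravar; [apply Rmult_lt_0_compat|]; auto. }
  assert (Hnull : forall y, null_seq (sol y)).
  { intros y; apply null_seq_le with (1 := Hsol y).
    replace (Finite 0) with (Finite (/ m * 0)) by (f_equal; ring).
    apply (is_lim_seq_scal_l _ (/ m) (Finite 0)).
    (* As [y] is a null sequence, the perturbation [M * |y (k + 1)|] vanishes in the limit, which
       puts [sol y] in [c0]. *)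
    apply contraction_null with (fun k => M * Cmod (c0_val y (S k))) (/ rho); auto.
    replace (Finite 0) with (Finite (M * 0)) by (f_equal; ring).
    apply (is_lim_seq_scal_l _ M (Finite 0)).
    apply (is_lim_seq_incr_1 (fun k => Cmod (c0_val y k))), null_seq_Cmod, c0_null. }
  pose (g y := mk_c0 _ (Hnull y)).
  assert (Hgl : forall x, g (shifted (opB r s) l x) = x).
  { intros x; apply c0_ext; intros k.
    change (sol (shifted (opB r s) l x) k = x k); unfold sol.
    rewrite pairing_shifted; field; apply and_comm, Hnz. }
  assert (Hgr : forall y, shifted (opB r s) l (g y) = y).
  { intros y; apply c0_ext; intros [|k].
    - rewrite shifted_0; unfold g, sol; simpl; rewrite pairing_0.
      fold d; field; apply and_comm, Hnz.
    - rewrite shifted_S; unfold g, sol; simpl; rewrite pairing_S; fold d.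
      replace (phi (S k)) with (- (phi k * (d k / periodic s k)))%C by reflexivity.
      field; repeat split; auto; apply Hnz. }
  split; [|split].
  - intros x1 x2 H; rewrite <- (Hgl x1), H; apply Hgl.
  - exists g; split; [exact Hgl|].
    exists (/ m * (M / (1 - / rho))); intros y _.
    apply c0_norm_le; intros k.
    apply Rle_trans with (1 := Hsol y k); rewrite Rmult_assoc.
    apply Rmult_le_compat_l; [left; now apply Rinv_0_lt_compat|].
    apply Rle_trans with (1 := Hub y k); right; unfold norm; simpl; field; lra.
  (* The right inverse makes the range the whole space, so [y] approximates itself. *)
  - intros y e; exists y; split; [exists (g y); now rewrite Hgr | apply ball_center].
Qed.

(** * Growth of [phi] when both diagonals have period [n] *)

Variable n : nat.
Hypothesis n_pos : (0 < n)%nat.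
Hypothesis r_periodic : forall k, periodic r (k + n) = periodic r k.
Hypothesis s_periodic : forall k, periodic s (k + n) = periodic s k.

(** The factors [d_j / s_j] are [n]-periodic, so those from index [n] on repeat those from index
    0. *)
Lemma Cmod_annihilator_add (k : nat) :
  Cmod (phi (k + n)) = Cmod (phi n) * Cmod (phi k).
Proof.
  unfold phi; induction k as [|k IH]; simpl.
  - rewrite Cmod_1; ring.
  - unfold diag; rewrite !Cmod_opp, !Cmod_mult, IH, r_periodic, s_periodic; ring.
Qed.

(** A zero of [phi] propagates to all later indices. A first zero at [S k] would thus kill
    [phi (k + n)], whose modulus is the nonzero product [|phi n| * |phi k|]. *)
Lemma annihilator_neq_0 : phi n <> RtoC 0 -> forall k, phi k <> RtoC 0.
Proof.
  intros Hn; induction k as [|k IH]; [apply C1_nz|].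
  intros E; assert (Z : forall j, phi (S k + j) = RtoC 0).
  { induction j as [|j IHj]; [now rewrite Nat.add_0_r|].
    rewrite Nat.add_succ_r; unfold phi in *; simpl in *; rewrite IHj; ring. }
  specialize (Z (n - 1)%nat); replace (S k + (n - 1))%nat with (k + n)%nat in Z by lia.
  pose proof (Cmod_annihilator_add k) as H; rewrite Z, Cmod_0 in H.
  apply Cmod_gt_0 in Hn; apply Cmod_gt_0 in IH.
  pose proof (Rmult_lt_0_compat _ _ Hn IH); lra.
Qed.

(** Here [rho] is the mean growth factor of [phi] over a period. If it exceeds 1,
    [|phi k| / rho ^ k] is periodic and positive, hence bounded above and away from 0; otherwise
    [|phi|] does not increase over a period. The value [rho = 0] occurs when some diagonal entry
    equals [l]. *)
Lemma spectrum_iff_growth_le_1 (rho : R) :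
  0 <= rho -> Cmod (phi n) = rho ^ n -> spectrum (opB r s) l <-> rho <= 1.
Proof.
  intros Hrho Hn; split; intros H.
  - apply Rnot_lt_le; intros H1; apply H.
    assert (Hrhok : forall k, 0 < rho ^ k) by (intros k; apply pow_lt; lra).
    assert (Hphi : forall k, phi k <> RtoC 0).
    { apply annihilator_neq_0; apply Cmod_gt_0; rewrite Hn; apply Hrhok. }
    assert (Hd : forall k, d k <> RtoC 0).
    { intros k E; apply (Hphi (S k)); unfold phi, d in *; simpl; rewrite E; unfold Cdiv; ring. }
    destruct (periodic_pos_bounds (fun k => Cmod (phi k) / rho ^ k) n)
      as [m0 [M [_ [_ HM]]]]; auto.
    { intros k; rewrite Cmod_annihilator_add, Hn, pow_add; field.
      split; apply Rgt_not_eq, Hrhok. }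
    { intros k; apply Rdiv_lt_0_compat; auto; now apply Cmod_gt_0. }
    destruct (periodic_pos_bounds (fun k => Cmod (phi k * d k) / rho ^ k) n)
      as [m [M' [Hm [_ Hm']]]]; auto.
    { intros k; rewrite !Cmod_mult, Cmod_annihilator_add, Hn, pow_add.
      unfold d, diag; rewrite r_periodic; field.
      split; apply Rgt_not_eq, Hrhok. }
    { intros k; apply Rdiv_lt_0_compat; auto; apply Cmod_gt_0, Cmult_neq_0; auto. }
    apply annihilator_growth_resolvent with rho m M; auto; intros k.
    + apply (proj1 (Rle_div_l _ _ _ (Hrhok k))), HM.
    + apply (proj2 (Rle_div_r _ _ _ (Hrhok k))), Hm'.
  - destruct (periodic_le_bounded (fun k => Cmod (phi k)) n) as [M [_ HM]]; auto.
    { intros k; rewrite Cmod_annihilator_add, Hn.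
      rewrite <- (Rmult_1_l (Cmod (phi k))) at 2.
      apply Rmult_le_compat_r; [apply Cmod_ge_0|].
      rewrite <- (pow1 n); now apply pow_incr. }
    apply annihilator_bounded_spectrum with M; auto.
Qed.

End Annihilator.

(** * The periods 4 and 6: growth over their common period *)

Theorem theorem4p2 (r1 r2 r3 r4 s1 s2 s3 s4 s5 s6 : C)
    (hs1 : s1 <> RtoC 0) (hs2 : s2 <> RtoC 0) (hs3 : s3 <> RtoC 0)
    (hs4 : s4 <> RtoC 0) (hs5 : s5 <> RtoC 0) (hs6 : s6 <> RtoC 0) :
  forall l : C,
    spectrum (opB [r1; r2; r3; r4] [s1; s2; s3; s4; s5; s6]) l <->
    nroot 4 (Cmod (l - r1) * Cmod (l - r2) * Cmod (l - r3) * Cmod (l - r4)) <=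
    nroot 6 (Cmod s1 * Cmod s2 * Cmod s3 * Cmod s4 * Cmod s5 * Cmod s6).
Proof.
  intros l.
  set (P := Cmod (l - r1) * Cmod (l - r2) * Cmod (l - r3) * Cmod (l - r4)).
  set (Q := Cmod s1 * Cmod s2 * Cmod s3 * Cmod s4 * Cmod s5 * Cmod s6).
  assert (HP : 0 <= P) by (unfold P; repeat apply Rmult_le_pos; apply Cmod_ge_0).
  pose proof (proj1 (Cmod_gt_0 _) hs1) as Hs1; pose proof (proj1 (Cmod_gt_0 _) hs2) as Hs2.
  pose proof (proj1 (Cmod_gt_0 _) hs3) as Hs3; pose proof (proj1 (Cmod_gt_0 _) hs4) as Hs4.
  pose proof (proj1 (Cmod_gt_0 _) hs5) as Hs5; pose proof (proj1 (Cmod_gt_0 _) hs6) as Hs6.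
  assert (HQ : 0 < Q) by (unfold Q; repeat apply Rmult_lt_0_compat; assumption).
  pose proof (nroot_ge_0 4 P) as Hp; pose proof (nroot_pow 4 P ltac:(lia) HP) as Ep.
  pose proof (nroot_ge_0 6 Q) as Hq; pose proof (nroot_pow 6 Q ltac:(lia) ltac:(lra)) as Eq.
  set (p := nroot 4 P) in *; set (q := nroot 6 Q) in *.
  assert (Hq0 : 0 < q).
  { destruct Hq as [|E]; auto; rewrite <- E in Eq; simpl in Eq; lra. }
  (* 12 is the least common multiple of 4 and 6. It contains three cycles of the [r_i] and two of
     the [s_i], so [|phi 12| = P^3 / Q^2 = (p / q)^12]. *)
  rewrite (spectrum_iff_growth_le_1 _ _ l) with (n := 12%nat) (rho := p / q).
  - rewrite Rle_div_l by exact Hq0; now rewrite Rmult_1_l.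
  - intros k; unfold periodic.
    pose proof (Nat.mod_upper_bound k 6 ltac:(lia)) as Hk; simpl length.
    (* The remainder stays below 6, so the default value 0 of [nth] is never read. *)
    destruct (k mod 6) as [|[|[|[|[|[|j]]]]]]; simpl; auto; lia.
  - lia.
  - intros k; apply periodic_add; exists 3%nat; reflexivity.
  - intros k; apply periodic_add; exists 2%nat; reflexivity.
  - now apply Rdiv_le_0_compat.
  - replace ((p / q) ^ 12) with ((p ^ 4) ^ 3 / (q ^ 6) ^ 2) by (field; lra).
    rewrite Ep, Eq; unfold P, Q.
    (* The statement uses [l - r_i], whereas [diag] uses [r_i - l]. *)
    assert (Hsym : forall z, Cmod (l - z) = Cmod (z - l)).
    { intros z; rewrite <- Cmod_opp; f_equal; ring. }
    rewrite !Hsym.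
    change (Cmod (annihilator [r1; r2; r3; r4] [s1; s2; s3; s4; s5; s6] l 12)
      = (Cmod (r1 - l) * Cmod (r2 - l) * Cmod (r3 - l) * Cmod (r4 - l)) ^ 3 /
        (Cmod s1 * Cmod s2 * Cmod s3 * Cmod s4 * Cmod s5 * Cmod s6) ^ 2).
    cbn [annihilator]; unfold diag, periodic; cbn [length Nat.modulo Nat.divmod fst snd Nat.sub nth].
    repeat (rewrite ?Cmod_opp, ?Cmod_mult, ?Cmod_div by assumption).
    rewrite Cmod_1; field; lra.
Qed.
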